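(* Assume that, for each $v\in\{0,1\}$, the intersection of $\{x:U(x,v)=0\}$ with the invariant set of $F_v$ contains only the origin. Then the stabilizing action dependent value iteration converges to the optimal action dependent value function of the infinite-horizon problem within the selected compact domain $\Omega$: if $V^0(\cdot,\cdot)=V_w(\cdot,\cdot)$ is the action dependent value function of an admissible triggering policy $w(\cdot)$ and $$V^{i+1}(x,v)=U(x,v)+\min_{w'\in\{0,1\}}V^i\big(F_v(x),w'\big),\quad\forall x,\ \forall v\in\{0,1\},$$ then $\lim_{i\to\infty}V^i(x,v)=V^*(x,v)$ for all $x\in\Omega$ and all $v\in\{0,1\}$.
   Context: Setting. A plant $x_{k+1}=f(x_k,u_k)$ has $f:\mathbb{R}^n\times\mathbb{R}^m\to\mathbb{R}^n$ continuous, $f(0,0)=0$, and a continuous control policy $h:\mathbb{R}^n\to\mathbb{R}^m$ is given, admissible in the sense that $h(0)=0$, $h$ asymptotically stabilizes $x_{k+1}=f(x_k,h(x_k))$ within the compact set $\Omega$, and $V_h(x_0):=\sum_{k=0}^\infty U(x_k^h,0)$ is continuous in $\Omega$, where $x_0^h=x_0$, $x_k^h=f(x_{k-1}^h,h(x_{k-1}^h))$. The switched system is $x_{k+1}=F_{v_k}(x_k)$, $v_k\in\{0,1\}$, with $F_0(x)=f(x,0)$ (network not used) and $F_1(x)=f(x,h(x))$ (network used). The infinite-horizon cost is $J=\sum_{k=0}^\infty U(x_k,v_k)$, where $U:\mathbb{R}^n\times\{0,1\}\to\mathbb{R}^+$ ($\mathbb{R}^+$ denotes the non-negative reals) is positive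 semi-definite and continuous in its first argument. Meaning of the invariant-set assumption: there is no set of states other than $\{0\}$ in which a trajectory can stay forever with zero running cost, i.e. without converging to the origin. A triggering policy is a map $w(\cdot)$ from states to $\{0,1\}$. Its action dependent value function is $V_w(x_0,v):=U(x_0,v)+\sum_{k=1}^\infty U(x_k^w,w(x_k^w))$, where $x_1^w:=F_v(x_0)$ and $x_k^w:=F_{w(x_{k-1}^w)}(x_{k-1}^w)$ for $k\ge2$. It is admissible if $V_w(\cdot,v)$ is continuous (hence bounded) in the compact set $\Omega$ for every $v\in\{0,1\}$. It satisfies $V_w(x,v)=U(x,v)+V_w(F_v(x),w(F_v(x)))$. The optimal action dependent value function $V^*(x,v)$ is the infinite-horizon cost incurred if action $v$ is taken at the current time from state $x$ and optimal actions are taken at all future times; it satisfies $V^*(x,v)=U(x,v)+\min_{w'\in\{0,1\}}V^*(F_v(x),w')$. Stabilizing action dependent value iteration is the recursion displayed in the claim, initiated with the action dependent value function of an admissible triggering policy.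
   Formalization: The invariant-set assumption is imposed on trajectories that may switch modes, not on each F_v alone; and it is added that from each x in Ω and first action v some optimal trajectory visits Ω at arbitrarily late times. The claim fails without these (free switching cycles, cheap escape to infinity). *)

(* Defs.v *)
From HB Require Import structures.
From mathcomp Require Import all_boot all_order all_algebra.
From mathcomp Require Import all_classical all_reals all_analysis.
Set Implicit Arguments.
Unset Strict Implicit.
Unset Printing Implicit Defensive.
Import Order.TTheory GRing.Theory Num.Theory.
Import numFieldNormedType.Exports.
Local Open Scope classical_set_scope.
Local Open Scope ring_scope.

(* Actions v in {0,1} are booleans, [true] meaning that the network is used.
   Infinite sums of nonnegative costs live in \bar R: off Omega nothing
   guarantees that they are finite. *)

Section Plant.
Variables (R : realType) (n m : nat).
Implicit Types (f : 'rV[R]_n -> 'rV[R]_m -> 'rV[R]_n).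
Implicit Types (h : 'rV[R]_n -> 'rV[R]_m).
Implicit Types (U : 'rV[R]_n -> bool -> R) (Omega : set 'rV[R]_n).

Definition mode f h (v : bool) (x : 'rV[R]_n) : 'rV[R]_n :=
  if v then f x (h x) else f x 0.

Definition pos_semidef (g : 'rV[R]_n -> R) : Prop :=
  g 0 = 0 /\ forall x, 0 <= g x.

Definition finite_continuous_on Omega (g : 'rV[R]_n -> \bar R) : Prop :=
  (forall x, Omega x -> g x \is a fin_num) /\
  {within Omega, continuous (fun x => fine (g x))}.

Definition asymptotically_stable_on Omega (g : 'rV[R]_n -> 'rV[R]_n) : Prop :=
  (forall e : R, 0 < e -> exists2 d : R, 0 < d &
     forall x, Omega x -> `|x| < d -> forall k, `|iter k g x| < e) /\
  (forall x, Omega x -> iter k g x @[k --> \oo] --> (0 : 'rV[R]_n)).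

Definition control_value f h U (x : 'rV[R]_n) : \bar R :=
  (\sum_(0 <= k <oo) (U (iter k (mode f h true) x) false)%:E)%E.

Definition admissible_control f U Omega h : Prop :=
  [/\ h 0 = 0,
      asymptotically_stable_on Omega (mode f h true) &
      finite_continuous_on Omega (control_value f h U)].

End Plant.

Section Switched.
Variables (R : realType) (n : nat).
Variables (F : bool -> 'rV[R]_n -> 'rV[R]_n) (U : 'rV[R]_n -> bool -> R).
Implicit Types (Omega S : set 'rV[R]_n) (x : 'rV[R]_n) (a : nat -> bool).

Fixpoint state x a (k : nat) : 'rV[R]_n :=
  if k is k'.+1 then F (a k') (state x a k') else x.

Definition cost x a : \bar R :=
  (\sum_(0 <= k <oo) (U (state x a k) (a k))%:E)%E.

Definition optimal_value x (v : bool) : \bar R :=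
  ereal_inf [set cost x a | a in [set a : nat -> bool | a 0%N = v]].

(* The sum starts at x_1 = F_v(x): its k-th term is the cost of x_{k+1}. *)
Definition policy_value (w : 'rV[R]_n -> bool) x (v : bool) : \bar R :=
  ((U x v)%:E +
   \sum_(0 <= k <oo)
     (let y := iter k (fun z => F (w z) z) (F v x) in U y (w y))%:E)%E.

Definition admissible_policy Omega (w : 'rV[R]_n -> bool) : Prop :=
  forall v, finite_continuous_on Omega (policy_value w ^~ v).

(* S is a set in which a trajectory of the switched system can stay forever
   with zero running cost. *)
Definition zero_cost_invariant S : Prop :=
  forall x, S x -> exists2 v, U x v = 0 & S (F v x).

(* The trajectory may switch between the modes.  Restricting it to a constant
   mode is not enough: F_0(x) = 2x, F_1(x) = x/2, U(x,0) = x^2 (x-1)^2 and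
   U(x,1) = x^2 (x-2)^2 allow the zero-cost cycle 1, 2, 1, 2, ... *)
Definition zero_cost_only_at_origin : Prop :=
  forall S, zero_cost_invariant S -> S `<=` [set 0].

Lemma zero_cost_only_at_origin_mode (v : bool) S :
  zero_cost_only_at_origin -> F v @` S `<=` S ->
  S `<=` [set x | U x v = 0] -> S `<=` [set 0].
Proof.
move=> H FS US; apply: H => x Sx; exists v; first exact: US.
by apply: FS; exists x.
Qed.

(* Optimal operation takes place in Omega: some optimal trajectory does not
   leave Omega for good.  Excursions out of Omega are allowed.  What this excludes
   is a cheap escape to infinity: F_0(x) = 2x, F_1(x) = x/2,
   U(x,0) = x^2 / (1 + x^4), U(x,1) = x^2, where applying mode 0 forever is
   cheaper than coming back to the origin. *)
Definition optimal_operation_in Omega : Prop :=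
  forall x v, Omega x ->
    exists a, [/\ a 0%N = v, cost x a = optimal_value x v &
      forall K, exists2 k, (K <= k)%N & Omega (state x a k)].

End Switched.

(* Main.v *)
Require Import Defs.
From HB Require Import structures.
From mathcomp Require Import all_boot all_order all_algebra.
From mathcomp Require Import all_classical all_reals all_analysis.
Set Implicit Arguments.
Unset Strict Implicit.
Unset Printing Implicit Defensive.
Import Order.TTheory GRing.Theory Num.Theory.
Import numFieldNormedType.Exports.
Local Open Scope classical_set_scope.
Local Open Scope ring_scope.

(* Each iterate V^i(x,v) is the cost of an actual trajectory that starts with
   the action v, hence at least V^*(x,v), and V^i decreases because V^0 comes
   from a policy.  Conversely V^i(x,v) is at most the cost of following an
   optimal trajectory x_k for i steps and the policy afterwards, that is, at
   most V^*(x,v) + V^0(x_i,a_i).  The costs along x_k are summable, so every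
   limit point of x_k has a zero-cost action leading to another limit point;
   the limit points thus form a zero-cost invariant set, which is {0}.  As x_k
   visits the compact set Omega infinitely often, it comes close to the origin
   within Omega, where V^0 is small by continuity. *)

Lemma cluster_seqP (T : topologicalType) (u : nat -> T) (y : T) :
  cluster (u k @[k --> \oo]) y <->
  (forall B, nbhs y B -> forall K, exists2 k, (K <= k)%N & B (u k)).
Proof.
split=> [uy B By K|uy A B [N _ NA] By].
  have [|_ [[k Kk <-] Bk]] := uy (u @` [set k | (K <= k)%N]) B _ By.
    by exists K => // k Kk; exists k.
  by exists k.
have [k Nk Bk] := uy B By N.
by exists (u k); split=> //; exact: NA.
Qed.

Section SwitchedTheory.
Variables (R : realType) (n : nat).
Variables (F : bool -> 'rV[R]_n -> 'rV[R]_n) (U : 'rV[R]_n -> bool -> R).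
Hypothesis U_ge0 : forall x v, 0 <= U x v.
Implicit Types (x y : 'rV[R]_n) (a : nat -> bool) (w : 'rV[R]_n -> bool).

Lemma state_shift x a k :
  state F x a k.+1 = state F (F (a 0%N) x) (fun j => a j.+1) k.
Proof. by elim: k => //= k <-. Qed.

Lemma state_policy w x k :
  state F x (fun j => w (iter j (fun z => F (w z) z) x)) k =
  iter k (fun z => F (w z) z) x.
Proof. by elim: k => //= k ->. Qed.

Lemma costS x a :
  cost F U x a =
  ((U x (a 0%N))%:E + cost F U (F (a 0%N) x) (fun j => a j.+1))%E.
Proof.
rewrite /cost nneseries_recl//; last by move=> k _; rewrite lee_fin.
congr (_ + _)%E; rewrite -nneseries_addn; last by move=> k; rewrite lee_fin.
by apply: eq_eseriesr => k _; rewrite addn1 state_shift.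
Qed.

Lemma policy_value_cost w x v :
  exists2 a, a 0%N = v & policy_value F U w x v = cost F U x a.
Proof.
(* The feedback [w] is read along its own trajectory as an open-loop sequence, with [v] put in
   front. *)
exists (fun k => if k is j.+1 then w (iter j (fun z => F (w z) z) (F v x))
                 else v) => //.
rewrite costS; congr (_ + _)%E.
by apply: eq_eseriesr => k _; rewrite /= state_policy.
Qed.

Lemma policy_valueS w x v :
  policy_value F U w x v =
  ((U x v)%:E + policy_value F U w (F v x) (w (F v x)))%E.
Proof.
congr (_ + _)%E; rewrite nneseries_recl//; last by move=> k _; rewrite lee_fin.
congr (_ + _)%E; rewrite -nneseries_addn; last by move=> k; rewrite lee_fin.
by apply: eq_eseriesr => k _; rewrite addn1 iterSr.
Qed.

Lemma policy_value0 w v : (forall b, F b 0 = 0) -> (forall b, U 0 b = 0) ->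
  policy_value F U w 0 v = 0%E.
Proof.
move=> F0 U0; rewrite /policy_value U0 F0 add0e eseries0// => k _ _.
suff -> : iter k (fun z => F (w z) z) 0 = 0 by rewrite /= U0.
by elim: k => //= k ->.
Qed.

Lemma optimal_value_le_cost x a :
  (optimal_value F U x (a 0%N) <= cost F U x a)%E.
Proof. by apply: ereal_inf_lbound; exists a. Qed.

Lemma cost_cvg0 x a : (cost F U x a < +oo)%E ->
  U (state F x a k) (a k) @[k --> \oo] --> (0 : R).
Proof. by move=> /nnseries_is_cvg xa; apply/cvg_series_cvg_0/xa. Qed.

(** Near a limit point, one action recurs infinitely often. Stage costs tend to 0, so this action
    costs nothing there, and the successors of these visits accumulate at its image. *)
Lemma cluster_state_zero_cost x a :
  (forall v, continuous (F v)) -> (forall v, continuous (U ^~ v)) ->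
  (cost F U x a < +oo)%E ->
  zero_cost_invariant F U (cluster (state F x a k @[k --> \oo])).
Proof.
move=> F_cont U_cont /cost_cvg0 U0 y /cluster_seqP yP.
(* Pigeonhole over the two actions: if each were excluded near [y] from some time on, a late visit
   to the intersection of both neighbourhoods would have no action left. *)
have [v vP] : exists v, forall B, nbhs y B -> forall K,
    exists k, [/\ (K <= k)%N, B (state F x a k) & a k = v].
  apply: contrapT => /forallNP no.
  have {}no v : exists B K, nbhs y B /\
      forall k, (K <= k)%N -> B (state F x a k) -> a k <> v.
    have /existsNP[B /not_implyP[By /existsNP[K Kno]]] := no v.
    by exists B, K; split=> // k Kk Bk akv; apply: Kno; exists k.
  have [[B [K [By nB]]] [C [L [Cy nC]]]] := (no true, no false).
  have [k + [Bk Ck]] := yP _ (filterI By Cy) (maxn K L).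
  rewrite geq_max => /andP[Kk Lk].
  by case ak : (a k); [exact: nB ak|exact: nC ak].
exists v.
  (* A positive [U y v] would keep the stage cost above half of it at infinitely many visits. *)
  apply/eqP; rewrite eq_le U_ge0 andbT leNgt; apply/negP => Uy.
  have Uy2 : U y v / 2 < U y v by rewrite gtr_pMr // invf_lt1 // ltr1n.
  have /= Bnear := U_cont v y _ (lt_nbhsr Uy2).
  have Uy0 : 0 < U y v / 2 by rewrite divr_gt0.
  have [N _ UN] := U0 _ (lt_nbhsl Uy0).
  have [k [Nk /= Bk akv]] := vP _ Bnear N.
  by have /= := UN k Nk; rewrite akv ltNge (ltW Bk).
apply/cluster_seqP => B FB K.
have [k [Kk Bk akv]] := vP _ (F_cont v y B FB) K.
by exists k.+1; [exact: leqW|rewrite /= akv].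
Qed.

(** Compactness gives the visits to [Omega] a limit point inside [Omega]; it is also a limit point
    of the whole trajectory, hence the origin. *)
Lemma recurrent_state_cvg0 (Omega : set 'rV[R]_n) x a :
  (forall v, continuous (F v)) -> (forall v, continuous (U ^~ v)) ->
  zero_cost_only_at_origin F U -> compact Omega ->
  (cost F U x a < +oo)%E ->
  (forall K, exists2 k, (K <= k)%N & Omega (state F x a k)) ->
  Omega 0 /\ forall B, nbhs (0 : 'rV[R]_n) B -> forall K,
    exists k, [/\ (K <= k)%N, Omega (state F x a k) & B (state F x a k)].
Proof.
move=> F_cont U_cont U_zero cO xa recur.
(* The times [g K] need not increase: [K <= g K] is enough to transfer limit points. *)
have /choice[g gP] : forall K, exists k, (K <= k)%N /\ Omega (state F x a k).
  by move=> K; have [k ? ?] := recur K; exists k.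
have [|y [Oy /cluster_seqP yg]] :=
    cO (fmap (state F x a \o g) \oo) (fmap_proper_filter _ _).
  by exists 0%N => // k _; exact: (gP k).2.
have y0 : y = 0.
  apply: (U_zero _ (cluster_state_zero_cost F_cont U_cont xa)).
  apply/cluster_seqP => B By K; have [k Kk Bk] := yg B By K.
  by exists (g k) => //; exact: leq_trans Kk (gP k).1.
move: Oy yg; rewrite y0 => zO yg; split=> // B B0 K.
have [k Kk Bk] := yg B B0 K.
by exists (g k); split=> //; [exact: leq_trans Kk (gP k).1|exact: (gP k).2].
Qed.

Variables (w : 'rV[R]_n -> bool) (V : nat -> 'rV[R]_n -> bool -> \bar R).
Hypothesis V0 : forall x v, V 0%N x v = policy_value F U w x v.
Hypothesis VS : forall i x v, V i.+1 x v =
  ((U x v)%:E + Order.min (V i (F v x) false) (V i (F v x) true))%E.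

Lemma iterate_minE i x : exists b,
  Order.min (V i x false) (V i x true) = V i x b.
Proof. by rewrite /Order.min; case: ifP => _; [exists false|exists true]. Qed.

Lemma iterate_min_le i x b :
  (Order.min (V i x false) (V i x true) <= V i x b)%E.
Proof. by rewrite ge_min; case: b; rewrite lexx ?orbT. Qed.

(** Each recursion step prepends one action to the trajectory of a minimising next action. *)
Lemma iterate_cost i x v :
  exists2 a, a 0%N = v & V i x v = cost F U x a.
Proof.
elim: i x v => [|i IH] x v; first by rewrite V0; exact: policy_value_cost.
have [b minE] := iterate_minE i (F v x).
have [a ab Va] := IH (F v x) b.
exists (fun k => if k is j.+1 then a j else v) => //.
by rewrite VS minE Va [RHS]costS.
Qed.

Lemma optimal_value_le_iterate i x v : (optimal_value F U x v <= V i x v)%E.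
Proof.
by have [a <- ->] := iterate_cost i x v; exact: optimal_value_le_cost.
Qed.

(** The first step minimises over the next action where the policy fixes it; monotonicity of the
    recursion propagates the inequality. *)
Lemma iterateS_le i x v : (V i.+1 x v <= V i x v)%E.
Proof.
elim: i x v => [|i IH] x v.
  by rewrite [leLHS]VS [leRHS]V0 policy_valueS leeD2l// -V0 iterate_min_le.
rewrite VS [leRHS]VS leeD2l//.
have [b ->] := iterate_minE i (F v x).
exact: le_trans (iterate_min_le _ _ b) (IH _ _).
Qed.

Lemma iterate_nonincreasing x v :
  {homo (fun i => V i x v) : i j / (i <= j)%N >-> (j <= i)%E}.
Proof.
by apply: homo_leq => [i|i j k ji kj|i];
  [exact: lexx|exact: le_trans kj ji|exact: iterateS_le].
Qed.

(** Each minimum is bounded by its value at the next action of [a]. Keeping the whole cost, not just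
    its first [i] terms, is harmless as all terms are nonnegative. *)
Lemma iterate_le_cost i x a :
  (V i x (a 0%N) <= cost F U x a + V 0%N (state F x a i) (a i))%E.
Proof.
elim: i x a => [|i IH] x a.
  rewrite leeDr//; apply: nneseries_ge0 => k _ _.
  by rewrite lee_fin.
rewrite VS costS -addeA leeD2l// state_shift.
exact: le_trans (iterate_min_le _ _ (a 1%N)) (IH _ (fun j => a j.+1)).
Qed.

Lemma iterate_cvg (Omega : set 'rV[R]_n) :
  (forall v, continuous (F v)) -> (forall v, F v 0 = 0) ->
  (forall v, continuous (U ^~ v)) -> (forall v, U 0 v = 0) ->
  zero_cost_only_at_origin F U -> compact Omega ->
  optimal_operation_in F U Omega -> admissible_policy F U Omega w ->
  forall x v, Omega x -> V i x v @[i --> \oo] --> optimal_value F U x v.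
Proof.
move=> F_cont F0 U_cont U0 U_zero cO opt_in w_adm x v Ox.
(* A nonincreasing sequence converges to its infimum. *)
suff -> : optimal_value F U x v = ereal_inf (range (fun i => V i x v)).
  exact/ereal_nonincreasing_cvgn/iterate_nonincreasing.
apply/eqP; rewrite eq_le; apply/andP; split.
  by apply: le_ereal_inf_tmp => _ [i _ <-]; exact: optimal_value_le_iterate.
have [a [a0 aopt recur]] := opt_in x v Ox.
have fin_cost : (cost F U x a < +oo)%E.
  rewrite aopt; apply: le_lt_trans (optimal_value_le_iterate 0 x v) _.
  by have [/(_ x Ox)] := w_adm v; rewrite V0 fin_numElt => /andP[].
have [zO visit0] :=
  recurrent_state_cvg0 F_cont U_cont U_zero cO fin_cost recur.
apply/lee_addgt0Pr => e e0.
(* [V 0] vanishes at the origin but is continuous only relative to [Omega], so the bound holds for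
   points of [Omega] only. *)
have smallV b : \forall y \near (0 : 'rV[R]_n),
    Omega y -> (V 0%N y b <= e%:E)%E.
  have [Vfin /subspace_continuousP /(_ 0 zO)] := w_adm b.
  rewrite /from_subspace policy_value0// => /(_ _ (lt_nbhsl e0)) near0.
  have Vlt : \forall y \near (0 : 'rV[R]_n),
      Omega y -> fine (policy_value F U w y b) < e := near0.
  apply: filterS Vlt => y ye Oy.
  by rewrite V0 -(fineK (Vfin y Oy)) lee_fin ltW// ye.
(* Both actions are made small at once, since [a k] is not known in advance; any time [k] serves, as
   the infimum is below every iterate. *)
have [k [_ Ok [Vt Vf]]] := visit0 _ (filterI (smallV true) (smallV false)) 0%N.
apply: (@le_trans _ _ (V k x v)); first by apply: ereal_inf_lbound; exists k.
rewrite -a0; apply: le_trans (iterate_le_cost k x a) _.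
rewrite aopt a0 leeD2l//.
by case: (a k); [exact: Vt|exact: Vf].
Qed.

End SwitchedTheory.

Theorem theorem4 (R : realType) (n m : nat)
  (f : 'rV[R]_n -> 'rV[R]_m -> 'rV[R]_n) (h : 'rV[R]_n -> 'rV[R]_m)
  (U : 'rV[R]_n -> bool -> R) (Omega : set 'rV[R]_n)
  (w : 'rV[R]_n -> bool) (V : nat -> 'rV[R]_n -> bool -> \bar R)
  (f_cont : continuous (fun p : 'rV[R]_n * 'rV[R]_m => f p.1 p.2))
  (f00 : f 0 0 = 0)
  (h_cont : continuous h)
  (Omega_compact : compact Omega)
  (U_psd : forall v, pos_semidef (U ^~ v))
  (U_cont : forall v, continuous (U ^~ v))
  (h_adm : admissible_control f U Omega h)
  (U_zero : zero_cost_only_at_origin (mode f h) U)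
  (opt_in : optimal_operation_in (mode f h) U Omega)
  (w_adm : admissible_policy (mode f h) U Omega w)
  (V0 : forall x v, V 0%N x v = policy_value (mode f h) U w x v)
  (VS : forall i x v,
     V i.+1 x v = ((U x v)%:E +
       Order.min (V i (mode f h v x) false) (V i (mode f h v x) true))%E) :
  forall x v, Omega x ->
    V i x v @[i --> \oo] --> optimal_value (mode f h) U x v.
Proof.
have [h0 _ _] := h_adm.
apply: (iterate_cvg _ V0 VS) => //.
- by move=> x v; have [_] := U_psd v; apply.
- case=> x; last exact: (cvg_comp2 cvg_id (cvg_cst _) (f_cont (x, 0))).
  exact: (cvg_comp2 cvg_id (h_cont x) (f_cont (x, h x))).
- by case; rewrite /mode ?h0.
- by move=> v; have [] := U_psd v.
Qed.
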